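(* Let $F$ be a field of characteristic zero, let $w=w_1w_2\ldots$ be an infinite binary word with slope $\pi(w)=\alpha$ whose combinatorial complexity function $Comp_w(n)$ has subexponential growth, and let $m\ge 2$ be an integer. Let $A=A(m,w)$ be the associated algebra over $F$. Then the PI-exponent $\exp(A)=\lim_{n\to\infty}\sqrt[n]{c_n(A)}$ exists, and $$\exp(A)=\Phi\left(\frac{1}{m+\alpha}\right),\qquad\text{where}\quad \Phi(x)=\frac{1}{x^x(1-x)^{1-x}}.$$
   Context: Algebras are not necessarily associative. **Codimensions.** Let $F\{X\}$ be the absolutely free (non-associative) $F$-algebra on an infinite set $X$ of free generators. A polynomial $f(x_1,\ldots,x_n)\in F\{X\}$ is an identity of an algebra $A$ if $f(a_1,\ldots,a_n)=0$ for all $a_1,\ldots,a_n\in A$; $Id(A)$ denotes the set of all identities of $A$. $P_n\subset F\{X\}$ is the subspace of all polynomials multilinear in $x_1,\ldots,x_n$, $P_n(A)=P_n/(P_n\cap Id(A))$ and $c_n(A)=\dim_F P_n(A)$. **Words.** An infinite binary word is $w=w_1w_2\ldots$ with $w_i\in\{0,1\}$. Subwords are contiguous: $w_{i+1}w_{i+2}\cdots w_{i+n}$, $i\ge 0$. $Comp_w(n)$ is the number of distinct subwords of $w$ of length $n$. A function $\varphi(n)$ of a natural argument is subexponential if $\lim_{n\to\infty}\varphi(n)/a^n=0$ for every real $a>1$. The slope of a finite binary word $u=u_1\cdots u_n$ is $\pi(u)=(u_1+\cdots+u_n)/n$. For the infinite word $w$ put $q_n=\min\{\pi(u) : u \text{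 a subword of } w \text{ of length } n\}$; the slope of $w$ is $\pi(w)=\liminf_{n\to\infty}q_n$. **The algebra $A(m,w)$.** For an integer $m\ge2$ and an infinite binary word $w$, put $k_i=m$ if $w_i=0$ and $k_i=m+1$ if $w_i=1$ ($i=1,2,\ldots$). $A(m,w)$ is the $F$-algebra with basis $\{a,b\}\cup\{z_j^{(i)} : i\ge 1,\ 1\le j\le k_i\}$ in which the only nonzero products of basis elements are, for all $i\ge1$, $$z_j^{(i)}a=z_{j+1}^{(i)}\ (2\le j\le k_i-1),\qquad z_{k_i}^{(i)}a=z_1^{(i)},\qquad z_1^{(i)}b=z_2^{(i+1)}.$$ *)

(* Defs.v *)
From HB Require Import structures.
From mathcomp Require Import all_boot all_order all_algebra.
From mathcomp Require Import all_classical all_reals all_analysis.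
From mathcomp Require Import freeg.

Set Implicit Arguments.
Unset Strict Implicit.
Unset Printing Implicit Defensive.

Import Order.TTheory GRing.Theory Num.Theory.
Import numFieldNormedType.Exports.
Local Open Scope classical_set_scope.
Local Open Scope ring_scope.

Section FgliftLinear.
Context (F : fieldType) (K : choiceType) (M : lmodType F).

Lemma fglift_zmod_morphism (f : K -> M) : zmod_morphism (fglift f).
Proof. exact: lift_is_additive. Qed.

HB.instance Definition _ (f : K -> M) :=
  GRing.isZmodMorphism.Build {freeg K / F} M (fglift f)
    (fglift_zmod_morphism f).

Lemma fglift_sumE (f : K -> M) (D : {freeg K / F}) :
  fglift f D = \sum_(x <- dom D) coeff x D *: f x.
Proof.
rewrite -[in LHS](freeg_sumE D) raddf_sum /=.
by apply: eq_bigr => x _; rewrite liftU.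
Qed.

Lemma fglift_linear (f : K -> M) : linear (fglift f).
Proof.
move=> c D1 D2; rewrite raddfD /=; congr (_ + _).
rewrite [c *: D1]/GRing.scale /= /fgscale raddf_sum /= fglift_sumE scaler_sumr.
by apply: eq_bigr => x _; rewrite liftU scalerA.
Qed.

HB.instance Definition _ (f : K -> M) :=
  GRing.isLinear.Build F {freeg K / F} M *:%R (fglift f) (fglift_linear f).

End FgliftLinear.

Record naAlg (F : fieldType) := NaAlg {
  naSort :> lmodType F;
  naMul : {bilinear naSort -> naSort -> naSort}
}.

Section TableAlgebra.
Context (F : fieldType) (B : choiceType) (tab : B -> B -> {freeg B / F}).

(* The bilinear extension of a multiplication table on the basis [B]. *)
Definition tableMul (x y : {freeg B / F}) : {freeg B / F} :=
  fglift (fun s => fglift (tab s) y) x.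

Lemma tableMul_bilinear : bilinear_for *:%R *:%R tableMul.
Proof.
split=> [y c x1 x2 | x c y1 y2]; first exact: fglift_linear.
rewrite /= /tableMul !fglift_sumE scaler_sumr -big_split /=.
apply: eq_bigr => s _; rewrite fglift_linear scalerDr.
by rewrite !scalerA mulrC.
Qed.

HB.instance Definition _ :=
  bilinear_isBilinear.Build F {freeg B / F} {freeg B / F} {freeg B / F}
    *:%R *:%R tableMul tableMul_bilinear.

Definition tableAlg : naAlg F :=
  @NaAlg F {freeg B / F} tableMul.

Lemma tableMulE (s t : B) : naMul tableAlg << s >> << t >> = tab s t.
Proof. by rewrite /= /tableMul !liftU !scale1r. Qed.

End TableAlgebra.

(* Bracketed words in x_0, x_1, x_2, ...: the basis of F{X}; [Var i] is x_i. *)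
Inductive monomial := Var of nat | Mul of monomial & monomial.

Fixpoint tree_of_monomial (u : monomial) : GenTree.tree nat :=
  match u with
  | Var i => GenTree.Leaf i
  | Mul u1 u2 => GenTree.Node 0 [:: tree_of_monomial u1; tree_of_monomial u2]
  end.

Fixpoint monomial_of_tree (t : GenTree.tree nat) : monomial :=
  match t with
  | GenTree.Leaf i => Var i
  | GenTree.Node _ [:: t1; t2] =>
      Mul (monomial_of_tree t1) (monomial_of_tree t2)
  | _ => Var 0
  end.

Lemma tree_of_monomialK : cancel tree_of_monomial monomial_of_tree.
Proof. by elim=> //= u1 -> u2 ->. Qed.

HB.instance Definition _ := Countable.copy monomial (can_type tree_of_monomialK).

Fixpoint vars (u : monomial) : seq nat :=
  match u with Var i => [:: i] | Mul u1 u2 => vars u1 ++ vars u2 end.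

Definition freeAlg (F : fieldType) : naAlg F :=
  tableAlg (fun u1 u2 : monomial => << Mul u1 u2 >> : {freeg monomial / F}).

Section Codimension.
Context (F : fieldType) (A : naAlg F).

Fixpoint monEval (rho : nat -> A) (u : monomial) : A :=
  match u with
  | Var i => rho i
  | Mul u1 u2 => naMul A (monEval rho u1) (monEval rho u2)
  end.

Definition polyEval (rho : nat -> A) (f : freeAlg F) : A :=
  fglift (monEval rho) f.

Lemma polyEval_mul (rho : nat -> A) (f g : freeAlg F) :
  polyEval rho (naMul (freeAlg F) f g)
  = naMul A (polyEval rho f) (polyEval rho g).
Proof.
rewrite /= /tableMul /polyEval (fglift_sumE (fun u => fglift _ g) f).
rewrite linear_sum (fglift_sumE _ f) linear_sumlz /=; apply: eq_bigr => u _.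
rewrite linearZ linearZl_LR /=; congr (_ *: _).
rewrite (fglift_sumE (fun v => << Mul u v >>) g) linear_sum (fglift_sumE _ g).
rewrite linear_sumr /=; apply: eq_bigr => v _.
by rewrite linearZ linearZr_LR /= liftU scale1r.
Qed.

Definition Id : set (freeAlg F) :=
  [set f | forall rho : nat -> A, polyEval rho f = 0].

End Codimension.

Arguments Id {F} A.

(* The space P_n: multilinear in x_1, ..., x_n (x_0 is not used). *)
Definition multilinear (F : fieldType) (n : nat) : set (freeAlg F) :=
  [set f : {freeg monomial / F} |
    forall u, u \in dom f -> perm_eq (vars u) (iota 1 n)].

Arguments multilinear : clear implicits.

(* [d] is the dimension of [P / (P `&` I)]: the classes of [e] form a basis. *)
Definition is_quot_dim (F : fieldType) (V : lmodType F) (P I : set V)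
    (d : nat) : Prop :=
  exists e : 'I_d -> V,
    [/\ forall i, P (e i),
        forall c : 'I_d -> F, I (\sum_i c i *: e i) -> forall i, c i = 0
      & forall v, P v -> exists c : 'I_d -> F, I (v - \sum_i c i *: e i)].

(* [multilinear F n] is finite-dimensional, so the default 0 is never used. *)
Definition codim (F : fieldType) (A : naAlg F) (n : nat) : nat :=
  xget 0%N [set d | is_quot_dim (multilinear F n) (Id A) d].

Definition codim_root (R : realType) (F : fieldType) (A : naAlg F) (n : nat) :
    R :=
  (codim A n)%:R `^ n%:R^-1.

Arguments codim_root R {F} A n.

Definition PIexp (R : realType) (F : fieldType) (A : naAlg F) : R :=
  limn (codim_root R A).

Arguments PIexp R {F} A.

(* An infinite binary word w_1 w_2 ... is a function with [w i] = w_{i+1}. *)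
Section Words.
Context (w : nat -> bool).

Definition subword (i n : nat) : n.-tuple bool := [tuple w (i + t) | t < n].

Definition is_subword (n : nat) (u : n.-tuple bool) : bool :=
  `[< exists i, u = subword i n >].

Definition Comp (n : nat) : nat := #|[pred u : n.-tuple bool | is_subword u]|.

End Words.

Definition subexponential (R : realType) (phi : nat -> nat) : Prop :=
  forall a : R, 1 < a -> (fun n : nat => (phi n)%:R / a ^+ n) @ \oo --> (0 : R).

Definition slope (R : realType) (n : nat) (u : n.-tuple bool) : R :=
  (\sum_(t < n) (tnth u t : nat))%:R / n%:R.

Arguments slope R {n} u.

Definition min_slope (R : realType) (w : nat -> bool) (n : nat) : R :=
  slope R [arg min_(u < subword w 0 n | is_subword w u) slope R u]%O.

Definition word_slope (R : realType) (w : nat -> bool) : R :=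
  limn_inf (min_slope R w).

Section WordAlgebra.
Context (m : nat) (w : nat -> bool).

Definition wlen (i : nat) : nat := if w i then m.+1 else m.

(* Indices start at 0: [gz i j] is the basis element z_{j+1}^{(i+1)}. *)
Inductive gen := ga | gb | gz (i : nat) of 'I_(wlen i).

Definition sum_of_gen (g : gen) : bool + {i : nat & 'I_(wlen i)} :=
  match g with
  | ga => inl true
  | gb => inl false
  | gz i j => inr (existT (fun i => 'I_(wlen i)) i j)
  end.

Definition gen_of_sum (s : bool + {i : nat & 'I_(wlen i)}) : gen :=
  match s with
  | inl true => ga
  | inl false => gb
  | inr p => gz (projT2 p)
  end.

Lemma sum_of_genK : cancel sum_of_gen gen_of_sum.
Proof. by case. Qed.

HB.instance Definition _ := Countable.copy gen (can_type sum_of_genK).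

Context (hm : (2 <= m)%N).

Lemma wlen_gt1 (i : nat) : (1 < wlen i)%N.
Proof. by rewrite /wlen; case: ifP => // _; apply: ltnW. Qed.

(* [ordS] is the cyclic successor, so z_2, ..., z_{k_i} are shifted by [ga],
   with z_{k_i} sent to z_1, while z_1 is annihilated by [ga]. *)
Definition word_table (F : fieldType) (s t : gen) : {freeg gen / F} :=
  match s, t with
  | gz i j, ga => if j == 0%N :> nat then 0 else << gz (ordS j) >>
  | gz i j, gb =>
      if j == 0%N :> nat then << gz (Ordinal (wlen_gt1 i.+1)) >> else 0
  | _, _ => 0
  end.

Definition wordAlg (F : fieldType) : naAlg F := tableAlg (word_table F).

End WordAlgebra.

Arguments wordAlg {m} w hm F.

Definition Phi (R : realType) (x : R) : R :=
  1 / (x `^ x * (1 - x) `^ (1 - x)).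

(* Main.v *)
Require Import Defs.
From HB Require Import structures.
From mathcomp Require Import all_boot all_order all_algebra.
From mathcomp Require Import all_classical all_reals all_analysis.
From mathcomp Require Import freeg zify ring lra.

Import Order.TTheory GRing.Theory Num.Theory.
Import numFieldNormedType.Exports.
Local Open Scope classical_set_scope.
Local Open Scope ring_scope.

Set Implicit Arguments.
Unset Strict Implicit.
Unset Printing Implicit Defensive.

(** Only left-normed monomials can be nonzero on [A(m,w)], and each basis element
    [z] admits exactly one word in [a], [b] of length [N] that does not kill it.
    Hence a multilinear polynomial of degree [N+1] is an identity iff it is killed
    by the functionals that sum the coefficients of the left-normed monomials
    starting with [x_i] whose later variables, the elements of a set [B] being
    replaced by [b] and the others by [a], spell a valid word [W].
    For fixed [W] there are [(N+1) * 'C(N, |W|_b)] of them, and they are independent;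
    the number of valid [W] is at most [(m+1) * Comp w (N+1)].  So up to a
    subexponential factor [c_(N+1)] is the largest ['C(N, |W|_b)].
    A factor [u] of [w] with [t] letters contributes [t] letters [b] to a word of
    length [t * (m + slope u)]; superadditivity turns the liminf defining the slope
    [alpha] of [w] into a limit, so the largest [|W|_b] is asymptotic to
    [N / (m + alpha)], while ['C(N, k)^(1/N)] is asymptotic to [Phi (k / N)]. *)

(** * Dimension of a quotient *)

Section QuotientDimension.
Context (F : fieldType) (V : lmodType F) (P I : set V).
Hypothesis P0 : P 0.
Hypothesis PL : forall c u v, P u -> P v -> P (c *: u + v).
Hypothesis IL : forall c u v, I u -> I v -> I (c *: u + v).

Lemma closed_lincomb d (e : 'I_d -> V) (c : 'I_d -> F) :
  (forall i, P (e i)) -> P (\sum_i c i *: e i).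
Proof.
move=> Pe; elim/big_rec: _ => [|i v _ Pv]; first exact: P0.
exact: PL.
Qed.

(** A left kernel vector of the matrix of values of [phi] on [e] gives a combination killed by all
    the functionals; it lies in [I], so its coefficients vanish. Hence the [d] rows are independent
    vectors with [#|A|] coordinates. *)
Lemma indep_mod_le d (e : 'I_d -> V) (T : finType) (A : {set T})
    (phi : T -> {linear V -> F^o}) :
  (forall i, P (e i)) ->
  (forall c : 'I_d -> F, I (\sum_i c i *: e i) -> forall i, c i = 0) ->
  (forall v, P v -> (forall t, t \in A -> phi t v = 0) -> I v) ->
  (d <= #|A|)%N.
Proof.
move=> Pe free ker.
pose M : 'M[F]_(d, #|A|) := \matrix_(i, j) (phi (enum_val j) (e i) : F).
suff : row_free M by rewrite -row_leq_rank => /leq_trans; apply; exact: rank_leq_col.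
apply/row_freeP; apply/row_freeP.
rewrite -kermx_eq0; apply/eqP/row_matrixP => k; rewrite row0.
have : row k (kermx M) *m M = 0 by rewrite -row_mul mulmx_ker row0.
move: (row k (kermx M)) => c cM; apply/rowP => i; rewrite mxE.
apply: (free (fun i => c 0 i)); apply: ker; first exact: closed_lincomb.
move=> t tA; rewrite linear_sum /=.
move/rowP/(_ (enum_rank_in tA t)): cM; rewrite !mxE => cM.
apply: etrans cM.
apply: eq_bigr => j _; rewrite linearZ /= mxE enum_rankK_in //.
Qed.

Lemma quot_dim_le d (T : finType) (A : {set T}) (phi : T -> {linear V -> F^o}) :
  (forall v, P v -> (forall t, t \in A -> phi t v = 0) -> I v) ->
  is_quot_dim P I d -> (d <= #|A|)%N.
Proof. by move=> ker [e [Pe free _]]; exact: indep_mod_le ker. Qed.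

(** Here the functionals must vanish on the elements of [I] in [P], the converse of the condition in
    [quot_dim_le]. Expanding the [u t] in the basis [e] modulo [I] factors the identity matrix of
    size [#|A|] through dimension [d]. *)
Lemma quot_dim_ge d (T : finType) (A : {set T}) (phi : T -> {linear V -> F^o})
    (u : T -> V) :
  (forall v, P v -> I v -> forall t, t \in A -> phi t v = 0) ->
  (forall t, t \in A -> P (u t)) ->
  (forall s t, s \in A -> t \in A -> phi s (u t) = (s == t)%:R) ->
  is_quot_dim P I d -> (#|A| <= d)%N.
Proof.
move=> ker Pu phiu [e [Pe free span]].
have /choice [C CP] : forall j : 'I_#|A|, exists c : 'I_d -> F,
    I (u (enum_val j) - \sum_i c i *: e i).
  by move=> j; apply: span; apply: Pu; exact: enum_valP.
pose M : 'M[F]_(#|A|, d) := \matrix_(j, i) C j i.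
pose E : 'M[F]_(d, #|A|) := \matrix_(i, j) (phi (enum_val j) (e i) : F).
have ME : M *m E = 1%:M.
  apply/matrixP => j k; rewrite !mxE.
  have kA := enum_valP k; have jA := enum_valP j.
  have Pd : P (u (enum_val j) - \sum_i C j i *: e i).
    rewrite addrC -scaleN1r; apply: PL; last exact: Pu.
    exact: closed_lincomb.
  have := ker _ Pd (CP j) _ kA.
  rewrite linearB /= phiu // (inj_eq enum_val_inj) eq_sym => /eqP.
  rewrite subr_eq0 => /eqP ->; rewrite linear_sum /=; apply: eq_bigr => i _.
  by rewrite linearZ !mxE.
rewrite -(@mxrank1 F #|A|) -ME; apply: leq_trans (mulmx_max_rank _ _) _.
by [].
Qed.

(** The functionals bound the size of families independent modulo [I], so a largest one exists; it
    spans, since a vector outside its span would enlarge it. *)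
Lemma quot_dim_exists (T : finType) (A : {set T})
    (phi : T -> {linear V -> F^o}) :
  (forall v, P v -> (forall t, t \in A -> phi t v = 0) -> I v) ->
  I 0 -> exists d, is_quot_dim P I d.
Proof.
move=> ker I0.
pose Q d := `[< exists e : 'I_d -> V, (forall i, P (e i)) /\
  (forall c : 'I_d -> F, I (\sum_i c i *: e i) -> forall i, c i = 0) >].
have Q0 : exists d, Q d.
  by exists 0%N; apply/asboolP; exists (fun=> 0); split=> [[]//|c _ []].
have Qle d : Q d -> (d <= #|A|)%N.
  by move=> /asboolP[e [Pe free]]; exact: indep_mod_le ker.
case: (ex_maxnP Q0 Qle) => d /asboolP[e [Pe free]] dmax.
exists d, e; split=> // v Pv.
apply: contrapT => nspan.
suff /dmax : Q d.+1 by rewrite ltnn.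
apply/asboolP.
exists (fun i => oapp e v (unlift ord_max i)); split.
  by move=> i; case: unliftP => [j|] _ /=.
move=> c; rewrite big_ord_recr /= unlift_none /=.
under eq_bigr => i _ .
  have -> : widen_ord (leqnSn d) i = fintype.lift ord_max i.
    by apply: val_inj; rewrite /= /bump leqNgt ltn_ord.
  rewrite liftK /=; over.
move=> Ic.
(* Dividing by a nonzero last coefficient would put [v] in the span of [e] modulo [I]. *)
have c0 : c ord_max = 0.
  apply: contrapT => /eqP cn0; apply: nspan.
  exists (fun i => - ((c ord_max)^-1 * c (fintype.lift ord_max i))).
  have := IL ((c ord_max)^-1) Ic I0.
  rewrite addr0 scalerDr scalerA mulVf // scale1r addrC scaler_sumr.
  congr (I (_ + _)); rewrite -sumrN; apply: eq_bigr => i _.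
  by rewrite scaleNr opprK scalerA.
move: Ic; rewrite c0 scale0r addr0 => /free cl i.
by case: (unliftP ord_max i) => [j ->|->].
Qed.

End QuotientDimension.

(** * Words read along the basis of the algebra *)

Section WordCombinatorics.
Context (m : nat) (w : nat -> bool).
Hypothesis hm : (2 <= m)%N.

(** A plain sequence in place of the tuple [subword], so that factors concatenate without casts
    between tuple types. *)
Definition factor (i n : nat) : seq bool := map w (iota i n).

Lemma factorS i n : factor i n.+1 = w i :: factor i.+1 n.
Proof. by []. Qed.

Lemma factorD i n k : factor i (n + k) = factor i n ++ factor (i + n) k.
Proof. by rewrite /factor iotaD map_cat. Qed.

Lemma size_factor i n : size (factor i n) = n.
Proof. by rewrite size_map size_iota. Qed.

Lemma val_subword i n : subword w i n = factor i n :> seq bool.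
Proof.
apply: (@eq_from_nth _ false); first by rewrite size_tuple size_factor.
move=> t; rewrite size_tuple => tn; rewrite -[t]/(val (Ordinal tn)) -tnth_nth.
by rewrite tnth_mktuple (nth_map 0%N) ?size_iota // nth_iota.
Qed.

(* The word read on the way from z_2^{(i)} to z_2^{(i+1)} when w_i = c; [true] is b. *)
Definition block (c : bool) : seq bool :=
  rcons (nseq (if c then m else m.-1) false) true.

Definition blocks (u : seq bool) : seq bool := flatten (map block u).

Lemma size_block i : size (block (w i)) = wlen m w i.
Proof.
by rewrite size_rcons size_nseq /wlen; case: (w i) => //; rewrite prednK // ltnW.
Qed.

Lemma count_block c : count id (block c) = 1%N.
Proof. by rewrite /block -cats1 count_cat count_nseq. Qed.

Lemma count_blocks u : count id (blocks u) = size u.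
Proof.
by elim: u => //= c u; rewrite /blocks /= count_cat count_block => ->.
Qed.

(** A block has length [m] plus its letter of [w]; this is the origin of the denominator
    [m + alpha]. *)
Lemma size_blocks u : size (blocks u) = (m * size u + count id u)%N.
Proof.
elim: u => [|c u IH]; first by rewrite muln0.
rewrite /blocks /= size_cat -/(blocks u) IH size_rcons size_nseq mulnS.
by case: c => /=; rewrite ?prednK 1?ltnW //; lia.
Qed.

Lemma take_block_false M c : (M < size (block c))%N ->
  count id (take M (block c)) = 0%N.
Proof.
rewrite size_rcons ltnS /block => le; rewrite -cats1 takel_cat //.
by apply/eqP; rewrite eqn0Ngt -has_count -all_predC; apply/allP => x /mem_take /nseqP[->].
Qed.

(** The only [b] of a block is its last letter, so a prefix with [K] letters [b] contains the first
    [K] blocks entirely. *)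
Lemma size_blocks_count_take M u :
  (size (blocks (take (count id (take M (blocks u))) u)) <= M)%N.
Proof.
elim: u M => [|c u IH] M //.
rewrite /blocks /= -/(blocks u) take_cat; case: ltnP => h.
  by rewrite take_block_false.
rewrite count_cat count_block add1n /blocks /= size_cat -/(blocks _) -/(blocks _).
by have := IH (M - size (block c))%N; lia.
Qed.

Lemma count_take_drop M j s :
  (count id (take M (drop j s)) <= count id (take (M + j) s))%N.
Proof.
by rewrite take_drop -{2}(cat_take_drop j (take _ s)) count_cat leq_addl.
Qed.

(** For a basis element [gz], the one generator that does not kill it on the right: [true] for [b],
    [false] for [a]. The product is then [next]. *)
Definition letter (z : gen m w) : bool :=
  match z with gz _ j => j == 0%N :> nat | _ => false end.

Definition next (z : gen m w) : gen m w :=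
  match z with
  | gz i j => if j == 0%N :> nat then gz (Ordinal (wlen_gt1 w hm i.+1))
              else gz (ordS j)
  | z => z
  end.

Fixpoint run (N : nat) (z : gen m w) : seq bool :=
  if N is N'.+1 then letter z :: run N' (next z) else [::].

Lemma size_run N z : size (run N z) = N.
Proof. by elim: N z => //= N IH z; rewrite IH. Qed.

(* The number of steps from [gz i 1], that is z_2^{(i+1)}, to [gz i j]. *)
Definition offset (i j : nat) : nat := if j == 0%N then (wlen m w i).-1 else j.-1.

Lemma drop_block_last i : drop (wlen m w i).-1 (block (w i)) = [:: true].
Proof.
rewrite -size_block size_rcons /block -cats1 drop_cat ltnn subnn drop0 //.
Qed.

Lemma drop_block_pred i j : (0 < j < wlen m w i)%N ->
  drop j.-1 (block (w i)) = false :: drop j (block (w i)).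
Proof.
move=> /andP[j0 jw].
have jw' : (j.-1 < size (block (w i)))%N.
  by rewrite size_block (leq_ltn_trans (leq_pred _)).
rewrite (drop_nth false) // prednK //; congr (_ :: _).
rewrite /block nth_rcons size_nseq nth_nseq.
move: jw; rewrite -size_block size_rcons size_nseq ltnS => jw.
by rewrite (leq_trans _ jw) ?prednK.
Qed.

(** The path finishes the current block and then runs through the blocks of the following letters of
    [w]. Blocks are nonempty and the offset stays inside the first one, so [T > N] letters of [w]
    are enough. *)
Lemma run_gz N i (j : 'I_(wlen m w i)) T : (N < T)%N ->
  run N (gz j) = take N (drop (offset i j) (blocks (factor i T))).
Proof.
elim: N i j T => [|N IH] i j [|T] // NT; first by rewrite take0.
rewrite [LHS]/= /offset; case: (j =P 0%N :> nat) => [j0|/eqP j0].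
  rewrite factorS /blocks /= -/(blocks _) drop_cat size_block.
  rewrite prednK ?leqnn 1?(ltnW (wlen_gt1 w hm i)) //.
  by rewrite drop_block_last /= (IH _ _ T) // /offset /= drop0.
have jlt : (j.-1 < size (block (w i)))%N.
  by rewrite size_block (leq_ltn_trans (leq_pred _)).
have jw := ltn_ord j.
rewrite factorS {1}/blocks /= -/(blocks _) drop_cat jlt.
rewrite drop_block_pred ?lt0n ?j0 //=; congr (_ :: _).
rewrite (IH _ _ T.+1) ?(ltnW NT) // factorS {1}/blocks /= -/(blocks _) /offset.
(* In both cases the offset of [ordS j] is [j]: when [ordS] wraps around to [z_1], that offset is
   the last place of the block, which is [j]. *)
have [jl|jl] := ltnP j.+1 (wlen m w i).
  by rewrite modn_small //= drop_cat size_block jw.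
have je : j.+1 = wlen m w i by apply/eqP; rewrite eqn_leq jl jw.
by rewrite -{2}je modnn /= -{1}je /= drop_cat size_block jw.
Qed.

Definition valid (N : nat) (W : N.-tuple bool) : bool :=
  `[< exists i (j : 'I_(wlen m w i)), W = run N (gz j) :> seq bool >].

Definition validW (N : nat) : {set N.-tuple bool} := [set W | valid W]%SET.

Lemma offset_le i (j : 'I_(wlen m w i)) : (offset i j <= m)%N.
Proof.
have h : ((wlen m w i).-1 <= m)%N by rewrite /wlen; case: (w i) => //=; exact: leq_pred.
rewrite /offset; case: ifP => // _; apply: leq_trans h.
by have := ltn_ord j; lia.
Qed.

(** Completing the word on the left to the start of its first block costs at most [m] letters. The
    completed prefix has at least as many letters [b] as the word, hence contains that many whole
    blocks. *)
Lemma valid_count N (W : N.-tuple bool) : valid W ->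
  exists i, (m * count id W + count id (factor i (count id W)) <= N + m)%N.
Proof.
move=> /asboolP[i [j Wr]]; exists i.
have := run_gz j (ltnSn N); rewrite -Wr => {Wr}.
set o := offset i j; move=> WE.
set k := count id W; pose u := factor i N.+1.
set K := count id (take (N + o) (blocks u)).
have kK : (k <= K)%N by rewrite /k WE; exact: count_take_drop.
have := size_blocks_count_take (N + o) u; rewrite -/K size_blocks => h.
have kN : (k <= N)%N.
  by rewrite /k -[X in (_ <= X)%N](size_tuple W) count_size.
have sK : size (take k u) = k by rewrite size_takel // size_factor ltnW.
have kKs : (k <= size (take K u))%N.
  by rewrite size_take; case: ifP => // _; rewrite size_factor ltnW.
have uE : take k u = factor i k.
  by rewrite /u /factor -map_take take_iota; congr (map w (iota i _)); lia.
have cc : (count id (factor i k) <= count id (take K u))%N.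
  by rewrite -uE -(take_takel u kK) -{2}(cat_take_drop k (take K u)) count_cat
    leq_addr.
have := offset_le j; rewrite -/o.
have : (m * k <= m * size (take K u))%N by rewrite leq_mul2l kKs orbT.
by move: h cc; clear; lia.
Qed.

(** The path from [z_2] at level [i] reads whole blocks from its first letter on, and [t] of them
    fit into length [N]. *)
Lemma valid_exists N i t : (m * t + count id (factor i t) <= N)%N ->
  exists W : N.-tuple bool, valid W /\ (t <= count id W)%N.
Proof.
move=> h; pose z := @gz m w i (Ordinal (wlen_gt1 w hm i)).
have sz : size (run N z) == N by rewrite size_run.
exists (Tuple sz); split; first by apply/asboolP; exists i, (Ordinal (wlen_gt1 w hm i)).
rewrite /= (@run_gz _ _ _ (t + N.+1)); last by lia.
rewrite /offset /= drop0 factorD /blocks map_cat flatten_cat -/(blocks _).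
rewrite take_cat size_blocks size_factor ltnNge h /= count_cat count_blocks.
by rewrite size_factor leq_addr.
Qed.

(** By [run_gz] a valid word is determined by an offset between [0] and [m] and a factor of [w] of
    length [N.+1]. *)
Lemma card_validW N : (#|validW N| <= m.+1 * Comp w N.+1)%N.
Proof.
pose f (p : 'I_m.+1 * N.+1.-tuple bool) : seq bool := take N (drop p.1 (blocks p.2)).
(* The default of [insubd] only makes [g] total: the pairs obtained from valid words give sequences
   of size [N]. *)
pose g p : N.-tuple bool := insubd [tuple of nseq N false] (f p).
pose D := finset.setX [set: 'I_m.+1]%SET [set u : N.+1.-tuple bool | is_subword w u]%SET.
have -> : (m.+1 * Comp w N.+1)%N = #|D|.
  by rewrite cardsX cardsT card_ord /Comp cardsE.
apply: leq_trans (leq_imset_card g D); apply: subset_leq_card.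
apply/fintype.subsetP => W; rewrite finset.inE => /asboolP[i [j WE]].
apply/imsetP; exists (inord (offset i j), subword w i N.+1).
  by rewrite finset.in_setX !finset.inE; apply/asboolP; exists i.
apply: val_inj; rewrite /= val_insubd /f /= inordK ?ltnS ?offset_le //.
by rewrite val_subword -run_gz // size_run eqxx.
Qed.

End WordCombinatorics.

(** * Left-normed monomials *)

Section LeftNormed.

Fixpoint lnormed (u : monomial) : bool :=
  match u with
  | Var _ => true
  | Mul u1 (Var _) => lnormed u1
  | _ => false
  end.

Definition lnmon (i : nat) (s : seq nat) : monomial :=
  foldl (fun u j => Mul u (Var j)) (Var i) s.

Lemma vars_lnmon i s : vars (lnmon i s) = i :: s.
Proof.
by elim/last_ind: s => // s j IH; rewrite /lnmon foldl_rcons /= -/(lnmon _ _) IH cats1.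
Qed.

Lemma lnormed_lnmon i s : lnormed (lnmon i s).
Proof. by elim/last_ind: s => // s j IH; rewrite /lnmon foldl_rcons. Qed.

Lemma lnormedP u : lnormed u -> exists i s, u = lnmon i s.
Proof.
elim: u => [i _|u1 IH [j|] //= _ /IH[i [s ->]]]; first by exists i, [::].
by exists i, (rcons s j); rewrite /lnmon foldl_rcons.
Qed.

Definition reads (i : nat) (W : seq bool) (B : pred nat) (u : monomial) : bool :=
  [&& lnormed u, ohead (vars u) == Some i & map B (behead (vars u)) == W].

(** Merges [s] and [t], taking from [s] at the letters [b] of [W] and from [t] at the letters [a].
    The sizes assumed in [shuffleP] keep the default [0] of [head] out of reach. *)
Fixpoint shuffle (W : seq bool) (s t : seq nat) : seq nat :=
  match W with
  | true :: W' => head 0%N s :: shuffle W' (behead s) t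
  | false :: W' => head 0%N t :: shuffle W' s (behead t)
  | [::] => [::]
  end.

Lemma shuffleP W s t (B : pred nat) : size s = count id W ->
    size t = count negb W -> all B s -> all (predC B) t ->
  perm_eq (shuffle W s t) (s ++ t) /\ map B (shuffle W s t) = W.
Proof.
elim: W s t => [|[] W IH] s t /=; first by move=> /size0nil -> /size0nil ->.
  case: s => //= x s [] sW; rewrite add0n => tW /andP[Bx Bs] Bt.
  by have [p ->] := IH _ _ sW tW Bs Bt; rewrite Bx perm_cons.
case: t => //= x t; rewrite add0n => sW [] tW Bs /andP[Bx Bt].
have [p ->] := IH _ _ sW tW Bs Bt; rewrite (negbTE Bx); split=> //.
apply: perm_trans (_ : perm_eq (x :: s ++ t) _); first by rewrite perm_cons.
exact/permPl/(perm_catCA [:: x] s t).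
Qed.

(** As [s] has no repetition, membership in the selected subsequence gives back each bit of the
    mask. *)
Lemma map_mem_mask (W : seq bool) (s : seq nat) : uniq s -> size W = size s ->
  map (fun v => v \in mask W s) s = W.
Proof.
elim: s W => [|x s IH] [|c W] //= /andP[xs us] [sW].
have xm : x \notin mask W s by apply: contra xs => /mem_mask.
congr (_ :: _); first by case: c; rewrite ?mem_head // (negbTE xm).
rewrite -[RHS](IH W us sW); apply/eq_in_map => y ys.
case: c => //; rewrite in_cons; case: eqP => // yx.
by move: xs; rewrite -yx ys.
Qed.

End LeftNormed.

(** * Sets of variables to be replaced by [b] *)

Section BSets.
Context (N : nat).
Implicit Types (B : {set 'I_N.+2}) (W : N.-tuple bool) (i : 'I_N.+2).

(** Ordinals below [N.+2] stand for the variables from [x_0] to [x_(N+1)], so a variable and its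
    ordinal have the same value. *)
Definition mem_ord B : pred nat := fun v => inord v \in B.

(** [ord0] is excluded because [x_0] does not occur in multilinear polynomials, and [i] because
    [x_i] is the first variable. *)
Definition Bsets i k : {set {set 'I_N.+2}} :=
  [set B : {set 'I_N.+2} | (B \subset ~: [set ord0; i]) && (#|B| == k)]%SET.

Lemma card_Bsets i k : i != ord0 -> #|Bsets i k| = 'C(N, k).
Proof.
move=> i0; rewrite cards_draws; congr ('C(_, _)).
have := finset.cardsC [set ord0; i]%SET.
by rewrite finset.cards2 eq_sym i0 card_ord => -[].
Qed.

Definition Bset W (s : seq nat) : {set 'I_N.+2} :=
  [set v : 'I_N.+2 | val v \in mask W s]%SET.

Context (i : 'I_N.+2) (s : seq nat).
Hypothesis is_perm : perm_eq (val i :: s) (iota 1 N.+1).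

Let is_uniq : uniq (val i :: s).
Proof. by rewrite (perm_uniq is_perm) iota_uniq. Qed.

Let s_mem v : v \in s -> [/\ (0 < v)%N, (v < N.+2)%N & v != val i].
Proof.
move=> vs; have : v \in iota 1 N.+1 by rewrite -(perm_mem is_perm) in_cons vs orbT.
rewrite mem_iota add1n => /andP[-> ->]; split => //.
by apply: contraTneq vs => ->; case/andP: is_uniq.
Qed.

Lemma size_tail : size s = N.
Proof. by have := perm_size is_perm; rewrite /= size_iota => -[]. Qed.

Lemma Bset_valid W : Bset W s \in Bsets i (count id W).
Proof.
rewrite finset.inE; apply/andP; split.
  apply/fintype.subsetP => v; rewrite !finset.inE => /mem_mask /s_mem[v0 _ vi].
  by rewrite negb_or -!val_eqE /= -lt0n v0 vi.
have um : uniq (mask W s) by apply: mask_uniq; case/andP: is_uniq.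
have <- : size (mask W s) = count id W by rewrite size_mask // size_tuple size_tail.
rewrite cardE -(size_map val); apply/eqP/perm_size/uniq_perm => //.
  by rewrite map_inj_uniq ?enum_uniq //; exact: val_inj.
move=> v; apply/mapP/idP => [[x]|vm].
  by rewrite mem_enum finset.inE => xm ->.
have [_ vN _] := s_mem (mem_mask vm).
by exists (Ordinal vN); rewrite // mem_enum finset.inE.
Qed.

(** Once the order of the variables is fixed, exactly one admissible [B] makes them spell [W]. This
    uniqueness makes the readings dual to suitable monomials. *)
Lemma reads_Bset W B : B \in Bsets i (count id W) ->
  (map (mem_ord B) s == W) = (B == Bset W s).
Proof.
rewrite finset.inE => /andP[Bi _]; have us : uniq s by case/andP: is_uniq.
apply/eqP/eqP => [BW | ->].
  apply/finset.setP => v; rewrite finset.inE.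
  have mE : mask W s = seq.filter (mem_ord B) s by rewrite -BW filter_mask.
  rewrite mE mem_filter /mem_ord inord_val; case: (boolP (v \in B)) => //= vB.
  have := fintype.subsetP Bi _ vB; rewrite !finset.inE negb_or => /andP[v0 vi].
  have : val v \in val i :: s.
    by rewrite (perm_mem is_perm) mem_iota add1n ltn_ord andbT lt0n.
  by rewrite in_cons (inj_eq val_inj) (negbTE vi).
rewrite -[RHS](map_mem_mask us); last by rewrite size_tuple size_tail.
apply/eq_in_map => v /s_mem[_ vN _].
by rewrite /mem_ord finset.inE /= inordK.
Qed.

End BSets.

(** Put the elements of [B] at the letters [b] of [W], and the other variables except [x_i] at the
    letters [a]. *)
Lemma exists_reads N (i : 'I_N.+2) (W : N.-tuple bool) (B : {set 'I_N.+2}) :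
    i != ord0 -> B \in Bsets i (count id W) ->
  exists s, perm_eq (val i :: s) (iota 1 N.+1) /\ map (mem_ord B) s = W.
Proof.
move=> i0; rewrite finset.inE => /andP[Bi /eqP cB].
pose C : {set 'I_N.+2} := (~: [set ord0; i] :\: B)%SET.
have cC : #|C| = count negb W.
  have := finset.cardsC [set ord0; i]%SET.
  rewrite finset.cards2 eq_sym i0 card_ord => -[]; rewrite add0n => cI.
  rewrite finset.cardsDS // cI cB.
  have : (count id W + count negb W)%N = N.
    by rewrite -[RHS](size_tuple W) -(count_predC id W).
  by clear; lia.
pose sB := map val (enum B); pose sC := map val (enum C).
have [||||p Wr] := @shuffleP W sB sC (mem_ord B).
- by rewrite size_map -cardE.
- by rewrite size_map -cardE.
- by apply/allP => _ /mapP[x xB ->]; rewrite /mem_ord inord_val -mem_enum.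
- apply/allP => _ /mapP[x xC ->]; rewrite /= /mem_ord inord_val.
  by move: xC; rewrite mem_enum finset.inE => /andP[].
exists (shuffle W sB sC); split=> //.
have iotaE : iota 1 N.+1 = map val (rem (ord0 : 'I_N.+2) (enum 'I_N.+2)).
  by have := val_enum_ord N.+2; rewrite enum_ordSl /= => -[].
rewrite iotaE; have p' : perm_eq (val i :: shuffle W sB sC) (val i :: sB ++ sC).
  by rewrite perm_cons.
apply: (perm_trans p').
rewrite /sB /sC -map_cat -map_cons; apply: perm_map.
apply: uniq_perm.
- rewrite /= cat_uniq !enum_uniq /= andbT mem_cat !mem_enum !finset.inE eqxx orbT.
  rewrite /= andbF orbF; apply/andP; split.
    apply/negP => /(fintype.subsetP Bi); rewrite !finset.inE eqxx orbT //.
  by apply/hasPn => x; rewrite !mem_enum finset.inE => /andP[].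
- by rewrite rem_uniq // enum_uniq.
move=> x; rewrite mem_rem_uniq ?enum_uniq // !inE mem_cat !mem_enum !finset.inE.
rewrite andbT; case: (boolP (x \in B)) => xB /=.
  have := fintype.subsetP Bi _ xB; rewrite !finset.inE negb_or => /andP[-> _].
  by rewrite orbT.
by rewrite negb_or; case: eqP => [->|] /=; rewrite ?i0 ?andbT.
Qed.

(** * Products in the word algebra *)

Section WordAlgebraIdentities.
Context (F : fieldType) (m : nat) (w : nat -> bool) (hm : (2 <= m)%N).
Local Notation gen := (gen m w).
Local Notation A := (wordAlg w hm F).
Local Notation fr := {freeg gen / F}.
Local Notation mul := (naMul A).
Local Notation U := (fun g : gen => << g >> : A).

Definition isz (z : gen) : bool := if z is gz _ _ then true else false.

Definition symb (c : bool) : gen := if c then @gb m w else @ga m w.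

Lemma isz_next z : isz z -> isz (next hm z).
Proof. by case: z => //= i j _; case: ifP. Qed.

Lemma word_tableE z t : isz z ->
  word_table hm F z t = (t == symb (letter z))%:R *: << next hm z >>.
Proof.
case: z => //= i j _; case: t => [||i' j'] /=; case: ifP => _ /=;
  by rewrite ?eqxx ?scale1r // scale0r.
Qed.

Lemma coeff_sumE (x : fr) g :
  coeff g x = \sum_(t <- dom x) coeff t x * (t == g)%:R.
Proof. by rewrite {1}/coeff fglift_sumE. Qed.

Lemma mulE (x y : A) :
  mul x y = \sum_(s <- dom (x : fr)) \sum_(t <- dom (y : fr))
     (coeff s (x : fr) * coeff t (y : fr)) *: (word_table hm F s t : A).
Proof.
rewrite /= /tableMul fglift_sumE; apply: eq_bigr => s _.
rewrite fglift_sumE scaler_sumr; apply: eq_bigr => t _.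
by rewrite scalerA.
Qed.

Lemma mul_basis z (y : A) : isz z ->
  mul (U z) y = coeff (symb (letter z)) (y : fr) *: U (next hm z).
Proof.
move=> zz; rewrite /= /tableMul liftU scale1r fglift_sumE coeff_sumE scaler_suml.
by apply: eq_bigr => t _; rewrite word_tableE // scalerA.
Qed.

Lemma mul_basis0 z (y : A) : ~~ isz z -> mul (U z) y = 0.
Proof.
move=> zz; rewrite /= /tableMul liftU scale1r fglift_sumE.
by rewrite big1 // => t _; case: z zz => // _; case: t => *; rewrite scaler0.
Qed.

Lemma table_z s t c : coeff (symb c) (word_table hm F s t) = 0.
Proof.
have [zs|] := boolP (isz s); last first.
  by case: s => // _; case: t => *; rewrite coeff0.
rewrite word_tableE // coeffZ coeffU.
case: (_ =P symb c) => [E|]; last by rewrite !mulr0.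
by have := isz_next zs; rewrite E; case: c {E}.
Qed.

Lemma coeff_mul_symb c (x y : A) : coeff (symb c) (mul x y : fr) = 0.
Proof.
rewrite mulE raddf_sum big1 //= => s _; rewrite raddf_sum big1 //= => t _.
by rewrite coeffZ table_z mulr0.
Qed.

(** In the multiplication table every nonzero product has [a] or [b] as right factor. *)
Lemma mul_eq0 (x y : A) : (forall c, coeff (symb c) (y : fr) = 0) -> mul x y = 0.
Proof.
move=> y0; rewrite -[x](freeg_sumE (x : fr)) linear_sumlz big1 // => z _.
have -> : << coeff z (x : fr) *g z >> = coeff z (x : fr) *: (<< z >> : fr).
  by apply/eqP/freeg_eqP => t; rewrite coeffZ !coeffU mul1r.
rewrite linearZl_LR; have [zz|zz] := boolP (isz z).
  by rewrite mul_basis // y0 scale0r scaler0.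
by rewrite mul_basis0 // scaler0.
Qed.

(** In such a monomial some right factor is itself a product. The value of a product has no
    component on [a] or [b], so multiplying by it on the right gives zero. *)
Lemma monEval_not_lnormed (rho : nat -> A) u : ~~ lnormed u -> monEval rho u = 0.
Proof.
elim: u => // u1 IH [j|v1 v2] _ /=; first by move=> /IH ->; rewrite linear0l.
by move=> _; apply: mul_eq0 => c; rewrite coeff_mul_symb.
Qed.

Lemma monEval_lnmon (rho : nat -> A) i s :
  monEval rho (lnmon i s) = foldl mul (rho i) (map rho s).
Proof.
elim/last_ind: s => // s j IH.
by rewrite /lnmon foldl_rcons map_rcons foldl_rcons -IH.
Qed.

(** The scalar collected when a basis element is multiplied successively by the elements of [xs],
    where [W] is the word it accepts; see [foldl_basis]. *)
Definition readprod (W : seq bool) (xs : seq A) : F :=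
  \prod_(p <- zip W xs) coeff (symb p.1) (p.2 : fr).

Lemma foldl_mulZ c (x : A) xs : foldl mul (c *: x) xs = c *: foldl mul x xs.
Proof. by elim: xs x => //= y xs IH x; rewrite -IH linearZl_LR. Qed.

Lemma foldl_mulD (x y : A) xs :
  foldl mul (x + y) xs = foldl mul x xs + foldl mul y xs.
Proof. by elim: xs x y => //= z xs IH x y; rewrite -IH linearDl. Qed.

Lemma foldl_mul0 xs : foldl mul 0 xs = 0.
Proof. by elim: xs => //= z xs IH; rewrite linear0l. Qed.

Lemma foldl_basis z xs : isz z ->
  foldl mul (U z) xs =
  readprod (run hm (size xs) z) xs *: U (iter (size xs) (next hm) z).
Proof.
elim: xs z => [|x xs IH] z zz; first by rewrite /readprod big_nil scale1r.
rewrite [LHS]/= mul_basis // foldl_mulZ IH ?isz_next // scalerA.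
by rewrite /readprod /= big_cons /= -iterSr.
Qed.

Lemma foldl_basis0 z xs : ~~ isz z -> (0 < size xs)%N -> foldl mul (U z) xs = 0.
Proof. by case: xs => // x xs zz _ /=; rewrite mul_basis0 // foldl_mul0. Qed.

(** The components of [x] on [a] and [b] are killed by the first multiplication, so [xs] must be
    nonempty. *)
Lemma foldl_expand (x : A) xs : (0 < size xs)%N ->
  foldl mul x xs = \sum_(z <- dom (x : fr) | isz z)
    coeff z (x : fr) *: (readprod (run hm (size xs) z) xs *:
                          U (iter (size xs) (next hm) z)).
Proof.
move=> xs0; rewrite -{1}[x](freeg_sumE (x : fr)).
have -> (r : seq gen) (g : gen -> fr) : foldl mul (\sum_(z <- r) g z : A) xs =
    \sum_(z <- r) foldl mul (g z : A) xs.
  elim: r => [|z r IH]; first by rewrite !big_nil foldl_mul0.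
  by rewrite !big_cons foldl_mulD IH.
rewrite [RHS]big_mkcond; apply: eq_bigr => z _.
have -> : << coeff z (x : fr) *g z >> = coeff z (x : fr) *: (<< z >> : fr).
  by apply/eqP/freeg_eqP => t; rewrite coeffZ !coeffU mul1r.
rewrite foldl_mulZ; case: ifPn => zz; first by rewrite foldl_basis.
by rewrite foldl_basis0 // scaler0.
Qed.

End WordAlgebraIdentities.

(** * Codimensions *)

Section Codimension.
Context (F : fieldType) (m : nat) (w : nat -> bool) (hm : (2 <= m)%N).
Local Notation gen := (gen m w).
Local Notation A := (wordAlg w hm F).
Local Notation fr := {freeg gen / F}.
Local Notation mul := (naMul A).
Local Notation U := (fun g : gen => << g >> : A).
Local Notation free := {freeg monomial / F}.

Lemma readprod_map (P : pred nat) (rho : nat -> A) s :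
  readprod (map P s) (map rho s) =
  \prod_(v <- s) coeff (symb m w (P v)) (rho v : fr).
Proof.
rewrite /readprod; elim: s => [|v s IH] /=; first by rewrite !big_nil.
by rewrite !big_cons IH.
Qed.

Lemma readprod_basis (P : pred nat) W s : size W = size s ->
  readprod W (map (fun v => U (symb m w (P v))) s) = (map P s == W)%:R.
Proof.
rewrite /readprod; elim: s W => [|v s IH] [|c W] //=; first by rewrite big_nil.
move=> [sW]; rewrite big_cons IH //= coeffU mul1r eqseq_cons.
by case: c; case: (P v); rewrite /= ?eqxx ?mul1r ?mul0r.
Qed.

Definition reading (i : nat) (W : seq bool) (B : pred nat) : free -> F^o :=
  fglift (fun u => (reads i W B u)%:R : F^o).

HB.instance Definition _ i W B := GRing.Linear.on (reading i W B).

Lemma readingE i W B (f : free) :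
  reading i W B f = \sum_(u <- dom f) coeff u f * (reads i W B u)%:R.
Proof. by rewrite /reading fglift_sumE. Qed.

Lemma readingU i W B u : reading i W B << u >> = (reads i W B u)%:R.
Proof. by rewrite /reading liftU scale1r. Qed.

Context (N : nat) (N0 : (0 < N)%N).
Local Notation P := (multilinear F N.+1 : set free).

(** Under this substitution all monomials take values on one line, so a reading is a coordinate of
    the value of the polynomial. A left-normed monomial with another first variable starts with [a]
    or [b] and vanishes. *)
Lemma monEval_reads (i : nat) (z : gen) (B : pred nat) u :
    isz z -> perm_eq (vars u) (iota 1 N.+1) ->
  monEval (fun v => if v == i then U z else U (symb m w (B v))) u =
  (reads i (run hm N z) B u)%:R *: U (iter N (next hm) z).
Proof.
move=> zz pu; rewrite /reads.
have [/lnormedP[i0 [s E]] /=|nl] := boolP (lnormed u); last first.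
  by rewrite monEval_not_lnormed // scale0r.
rewrite E vars_lnmon in pu *; rewrite monEval_lnmon /=.
have uniq_s : uniq (i0 :: s) by rewrite (perm_uniq pu) iota_uniq.
have sN : size s = N by have := perm_size pu; rewrite /= size_iota => -[].
rewrite (inj_eq (@Some_inj _)); case: eqP => [ii|_]; last first.
  rewrite scale0r foldl_basis0 ?size_map ?sN //.
  by case: (B i0).
rewrite -{}ii in uniq_s *.
have -> : map (fun v => if v == i0 then U z else U (symb m w (B v))) s =
          map (fun v => U (symb m w (B v))) s.
  apply/eq_in_map => v vs; case: eqP => // vi.
  by move: uniq_s; rewrite /= -vi vs.
by rewrite foldl_basis // size_map sN readprod_basis // size_run.
Qed.

Lemma reading_Id (f : free) (i : nat) (z : gen) (B : pred nat) :
  isz z -> P f -> Id A f -> reading i (run hm N z) B f = 0.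
Proof.
move=> zz Pf /(_ (fun v => if v == i then U z else U (symb m w (B v)))).
rewrite /polyEval fglift_sumE.
under eq_big_seq => u uf do rewrite (monEval_reads i B zz (Pf u uf)) scalerA.
rewrite -scaler_suml -readingE => /(congr1 (coeff (iter N (next hm) z))).
by rewrite coeffZ coeffU eqxx !mulr1 coeff0.
Qed.

Definition head_readprod (rho : nat -> A) (i : nat) (W : seq bool) u : F :=
  if lnormed u && (ohead (vars u) == Some i)
  then readprod W (map rho (behead (vars u))) else 0.

(** Only [B = Bset W s] contributes, where [s] lists the variables of [u] after the first. The
    product on the right does not depend on [u], so summing over the monomials of a polynomial
    produces a combination of its readings. *)
Lemma head_readprodE (rho : nat -> A) (i : 'I_N.+2) (W : N.-tuple bool) u :
    perm_eq (vars u) (iota 1 N.+1) ->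
  head_readprod rho i W u =
  \sum_(B in Bsets i (count id W))
    (\prod_(v <- rem (val i) (iota 1 N.+1)) coeff (symb m w (mem_ord B v)) (rho v : fr)) *
    (reads i W (mem_ord B) u)%:R.
Proof.
move=> pu; rewrite /head_readprod /reads.
have [/lnormedP[i0 [s E]] /=|nl] := boolP (lnormed u); last first.
  by rewrite big1 // => B _; rewrite mulr0.
rewrite E vars_lnmon /= in pu *; case: eqP => [[ii]|_]; last first.
  by rewrite big1 // => B _; rewrite mulr0.
rewrite {}ii in pu *.
have ps : perm_eq (rem (val i) (iota 1 N.+1)) s.
  have iI : val i \in iota 1 N.+1 by rewrite -(perm_mem pu) mem_head.
  rewrite -(perm_cons (val i)) perm_sym; apply: (perm_trans pu).
  exact: perm_to_rem.
under eq_bigr => B BB do rewrite /= (reads_Bset pu BB).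
rewrite (bigD1 (Bset W s)) ?Bset_valid //= eqxx mulr1.
rewrite [X in _ + X]big1 ?addr0 => [|B /andP[_ /negbTE ->]]; last by rewrite mulr0.
rewrite (perm_big _ ps) /= -readprod_map.
by have := reads_Bset pu (Bset_valid pu W); rewrite eqxx => /eqP ->.
Qed.

Lemma monEval_expand (rho : nat -> A) u : perm_eq (vars u) (iota 1 N.+1) ->
  monEval rho u = \sum_(i < N.+2 | i != ord0)
    \sum_(z <- dom (rho i : fr) | isz z) coeff z (rho i : fr) *:
       (head_readprod rho i (run hm N z) u *: U (iter N (next hm) z)).
Proof.
move=> pu; rewrite /head_readprod.
have [/lnormedP[i0 [s E]] /=|nl] := boolP (lnormed u); last first.
  rewrite monEval_not_lnormed // big1 // => i _; rewrite big1 // => z _.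
  by rewrite scale0r scaler0.
rewrite E vars_lnmon /= in pu *.
have sN : size s = N by have := perm_size pu; rewrite /= size_iota => -[].
have : i0 \in iota 1 N.+1 by rewrite -(perm_mem pu) mem_head.
rewrite mem_iota add1n => /andP[i00 i0N]; pose i := Ordinal i0N.
rewrite (bigD1 i) /=; last by rewrite -val_eqE /= -lt0n.
rewrite [X in _ + X]big1 ?addr0 => [|j /andP[_ ji]]; last first.
  rewrite big1 // => z _; case: eqP => [[ij]|_]; last by rewrite scale0r scaler0.
  by case/eqP: ji; apply: val_inj.
by rewrite eqxx monEval_lnmon foldl_expand ?size_map ?sN.
Qed.

(** Expand the value at an arbitrary substitution by first variable, then by basis element [z], then
    by [B]. Exchanging the sums makes each coefficient a multiple of a reading of [f]. *)
Lemma Id_reading (f : free) : P f ->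
  (forall (i : 'I_N.+2) (W : N.-tuple bool) B, i != ord0 -> valid w hm W ->
     B \in Bsets i (count id W) -> reading i W (mem_ord B) f = 0) ->
  Id A f.
Proof.
move=> Pf f0 rho; rewrite /polyEval fglift_sumE.
under eq_big_seq => u uf do rewrite (monEval_expand rho (Pf u uf)) scaler_sumr.
rewrite exchange_big big1 //= => i i0.
under eq_bigr => u _ do rewrite scaler_sumr.
rewrite exchange_big big1 //= => z zz.
under eq_bigr => u _ do rewrite scalerA mulrC -scalerA.
rewrite -scaler_sumr.
under eq_bigr => u _ do rewrite scalerA.
rewrite -scaler_suml; apply/eqP; rewrite !scaler_eq0; apply/orP; right.
apply/orP; left; apply/eqP.
pose W : N.-tuple bool := Tuple (introT eqP (size_run hm N z)).
have vW : valid w hm W.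
  by apply/asboolP; case: z zz @W => // i1 j1 _; exists i1, j1.
rewrite -[run hm N z]/(val W).
under eq_big_seq => u uf do rewrite (head_readprodE rho i W (Pf u uf)) mulr_sumr.
rewrite exchange_big big1 //= => B BB.
under eq_bigr => u _ do rewrite mulrCA.
by rewrite -mulr_sumr -readingE (f0 i W B i0 vW BB) mulr0.
Qed.

Lemma multilinear0 : P 0.
Proof. by move=> u; rewrite dom0. Qed.

Lemma multilinear_lin c (f g : free) : P f -> P g -> P (c *: f + g).
Proof.
move=> Pf Pg u /domD_subset; rewrite mem_cat => /orP[/domZ_subset|]; first exact: Pf.
exact: Pg.
Qed.

Lemma Id_lin c (f g : free) : Id A f -> Id A g -> Id A (c *: f + g).
Proof.
move=> If Ig rho.
have -> : polyEval rho (c *: f + g) = c *: polyEval rho f + polyEval rho g.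
  exact: fglift_linear.
by rewrite If Ig scaler0 addr0.
Qed.

Definition reading_index : finType := ('I_N.+2 * N.-tuple bool * {set 'I_N.+2})%type.

Definition indexed_reading (t : reading_index) : {linear free -> F^o} :=
  reading t.1.1 t.1.2 (mem_ord t.2).

(** The set [S] is a parameter: the upper bound takes all valid words, the lower bound a single
    one. *)
Definition index_over (S : {set N.-tuple bool}) : {set reading_index} :=
  [set t : reading_index |
    [&& t.1.1 != ord0, t.1.2 \in S & t.2 \in Bsets t.1.1 (count id t.1.2)]]%SET.

Lemma card_index_over (S : {set N.-tuple bool}) :
  #|index_over S| = (N.+1 * \sum_(W in S) 'C(N, count id W))%N.
Proof.
rewrite -sum1_card.
rewrite (eq_bigl (fun t : reading_index =>
   ((t.1.1 != ord0) && (t.1.2 \in S)) &&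
   (t.2 \in Bsets t.1.1 (count id t.1.2)))); last first.
  by move=> t; rewrite finset.inE andbA.
rewrite -(pair_big_dep (fun p => (p.1 != ord0) && (p.2 \in S))
   (fun (p : 'I_N.+2 * N.-tuple bool) B => B \in Bsets p.1 (count id p.2))
   (fun _ _ => 1%N)) /=.
rewrite (eq_bigr (fun p : 'I_N.+2 * N.-tuple bool => 'C(N, count id p.2))); last first.
  by move=> p /andP[p0 _]; rewrite sum1_card card_Bsets.
rewrite -(pair_big_dep (fun i => i != ord0) (fun (i : 'I_N.+2) W => W \in S)
   (fun (i : 'I_N.+2) (W : N.-tuple bool) => 'C(N, count id W))) /=.
rewrite sum_nat_const; congr (_ * _)%N.
transitivity #|predC1 (ord0 : 'I_N.+2)|; first exact: eq_card.
by rewrite cardC1 card_ord.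
Qed.

Lemma indexed_reading_ker (f : free) : P f ->
  (forall t, t \in index_over (validW w hm N) -> indexed_reading t f = 0) -> Id A f.
Proof.
move=> Pf f0; apply: Id_reading => // i W B i0 vW BB.
by apply: (f0 (i, W, B)); rewrite finset.inE /= i0 finset.inE vW BB.
Qed.

(** Some dimension exists, so [xget] returns a true one and not its default. *)
Lemma codimP : is_quot_dim P (Id A : set free) (codim A N.+1).
Proof.
have I0 : Id A (0 : free) by move=> rho; rewrite /polyEval linear0.
have [d dP] := quot_dim_exists multilinear0 multilinear_lin Id_lin indexed_reading_ker I0.
exact: (@xgetPex _ 0%N _ (ex_intro _ d dP)).
Qed.

Lemma codim_le C : (forall W : N.-tuple bool, valid w hm W -> 'C(N, count id W) <= C)%N ->
  (codim A N.+1 <= N.+1 * (m.+1 * Comp w N.+1 * C))%N.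
Proof.
move=> hC.
apply: leq_trans (quot_dim_le multilinear0 multilinear_lin indexed_reading_ker codimP) _.
rewrite card_index_over leq_mul2l /=.
apply: leq_trans (_ : #|validW w hm N| * C <= _)%N.
  rewrite -sum_nat_const; apply: leq_sum => W; rewrite finset.inE; exact: hC.
by rewrite leq_mul2r card_validW orbT.
Qed.

(** For a single [W], each pair of a first variable and a set [B] has a monomial on which its
    reading is [1] and all the other readings are [0]. *)
Lemma codim_ge (W : N.-tuple bool) : valid w hm W ->
  (N.+1 * 'C(N, count id W) <= codim A N.+1)%N.
Proof.
move=> vW; pose S := [set W]%SET.
have -> : (N.+1 * 'C(N, count id W))%N = #|index_over S|.
  by rewrite card_index_over big_set1.
(* Outside the index set [Var 0] is a mere filler. *)
have /choice [u uP] : forall t : reading_index, exists u : monomial,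
    t \in index_over S -> exists s, [/\ u = lnmon t.1.1 s,
      perm_eq (val t.1.1 :: s) (iota 1 N.+1) & map (mem_ord t.2) s = W].
  move=> t; have [|tn] := boolP (t \in index_over S); last by exists (Var 0).
  rewrite finset.inE => /and3P[i0]; rewrite finset.inE => /eqP tW tB.
  have [s [ps sW]] := exists_reads i0 tB.
  by exists (lnmon t.1.1 s) => _; exists s; rewrite sW tW.
apply: (@quot_dim_ge F _ P (Id A) multilinear0 multilinear_lin _ _ (index_over S)
  indexed_reading (fun t => << u t >>) _ _ _ codimP).
- move=> f Pf If t; rewrite finset.inE => /and3P[_ ]; rewrite finset.inE => /eqP tW _.
  rewrite /indexed_reading tW; move: vW => /asboolP[i [j ->]].
  exact: reading_Id.
- by move=> t /uP[s [E ps _]] v; rewrite domU1 inE => /eqP ->; rewrite E vars_lnmon.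
move=> s t sA tA; rewrite [LHS](readingU s.1.1 s.1.2 (mem_ord s.2) (u t)); congr (_ %:R).
have [s' [-> ps tW]] := uP _ tA.
rewrite /reads lnormed_lnmon vars_lnmon /=.
move: sA tA; rewrite !finset.inE => /and3P[s0 /eqP sW sB] /and3P[t0 /eqP tW' tB].
case: s sB s0 sW => [[i V] B] /= sB s0 sW.
case: t ps tW tB t0 tW' => [[j V'] B'] /= ps tW tB t0 tW'.
subst V V'; rewrite !xpair_eqE eqxx andbT (inj_eq (@Some_inj _)) val_eqE eq_sym.
case: eqP => //= ij; subst j.
have {}sB : B \in Bsets i (count id W) by rewrite finset.inE.
have {}tB : B' \in Bsets i (count id W) by rewrite finset.inE.
rewrite (reads_Bset ps sB).
by have := reads_Bset ps tB; rewrite tW eqxx => /esym/eqP <-.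
Qed.

End Codimension.

(** * Slopes *)

Section Slopes.
Context (R : realType) (w : nat -> bool).
Local Notation q := (min_slope R w).
Local Notation ones i n := (count id (factor w i n)).

Lemma slope_subword i n : slope R (subword w i n) = (ones i n)%:R / n%:R.
Proof.
rewrite /slope; congr (_%:R / _).
rewrite -val_subword -sumn_count sumnE big_map.
by rewrite big_tuple; apply: eq_bigr => t _; case: (tnth _ t).
Qed.

Lemma is_subwordT i n : is_subword w (subword w i n).
Proof. by apply/asboolP; exists i. Qed.

Lemma min_slope_le i n : q n <= (ones i n)%:R / n%:R.
Proof.
rewrite /min_slope -slope_subword; case: arg_minP => [|u _ h].
  exact: is_subwordT.
exact/h/is_subwordT.
Qed.

Lemma min_slope_attained n : exists i, q n = (ones i n)%:R / n%:R.
Proof.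
rewrite /min_slope; case: arg_minP => [|u /asboolP[i ->] _]; first exact: is_subwordT.
by exists i; rewrite slope_subword.
Qed.

Lemma min_slope_ge0 n : 0 <= q n.
Proof. by have [i ->] := min_slope_attained n; rewrite divr_ge0. Qed.

Lemma min_slope_le1 n : q n <= 1.
Proof.
apply: le_trans (min_slope_le 0 n) _; case: n => [|n]; first by rewrite invr0 mulr0.
by rewrite ler_pdivrMr // mul1r ler_nat -{2}(size_factor w 0 n.+1) count_size.
Qed.

Lemma ones_ge i n : q n * n%:R <= (ones i n)%:R.
Proof.
case: n => [|n]; first by rewrite mulr0.
by rewrite -ler_pdivlMr ?ltr0n // min_slope_le.
Qed.

Lemma onesD i n k : ones i (n + k) = (ones i n + ones (i + n) k)%N.
Proof. by rewrite factorD count_cat. Qed.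

Lemma ones_superadditive t j r i : q t * (j * t)%:R <= (ones i (j * t + r))%:R.
Proof.
elim: j i => [|j IH] i; first by rewrite mul0n mulr0.
rewrite mulSn -addnA onesD !natrD mulrDr lerD ?ones_ge //.
Qed.

(** Cut a factor of length [n] into pieces of length [t], each with at least [q t * t] ones. The
    remainder has fewer than [t] letters and [q t <= 1], so the loss in slope is at most [t / n]. *)
Lemma min_slope_superadditive t n : (0 < t)%N -> (0 < n)%N ->
  q t - t%:R / n%:R <= q n.
Proof.
move=> t0 n0; have [i ->] := min_slope_attained n.
have := ones_superadditive t (n %/ t) (n %% t) i; rewrite -divn_eq => h.
rewrite ler_pdivlMr ?ltr0n // mulrBl divfK ?pnatr_eq0 -?lt0n //.
apply: le_trans h.
rewrite lerBlDr.
have : n%:R <= (n %/ t * t)%:R + t%:R :> R.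
  by rewrite -natrD ler_nat {1}(divn_eq n t) leq_add2l ltnW // ltn_pmod.
move=> h1; apply: le_trans (ler_wpM2l (min_slope_ge0 t) h1) _.
by rewrite mulrDr lerD2l ler_piMl // min_slope_le1.
Qed.

Lemma bounded_min_slope : bounded_fun q.
Proof.
exists 1; split => // M M1 n _ /=; rewrite ger0_norm ?min_slope_ge0 //.
exact: le_trans (min_slope_le1 n) (ltW M1).
Qed.

Lemma has_lbound_min_slope : has_lbound (range q).
Proof. exact: bounded_fun_has_lbound bounded_min_slope. Qed.

Lemma infs_le_word_slope n : infs q n <= word_slope R w.
Proof.
rewrite /word_slope limn_infE; last exact: bounded_min_slope.
apply: ub_le_sup; last by exists n.
exact: bounded_fun_has_ubound_infs bounded_min_slope.
Qed.

Lemma infs_min_slope_le n k : (n <= k)%N -> infs q n <= q k.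
Proof.
move=> nk; apply: ge_inf; last by exists k.
exact: has_lbound_sdrop has_lbound_min_slope n.
Qed.

Lemma min_slope_le_word_slope t : (0 < t)%N -> q t <= word_slope R w.
Proof.
move=> t0; apply/ler_addgt0Pr => e e0.
(* From this length on the loss [t / k] is at most [e], hence [q t - e] bounds the tail infimum from
   below. *)
have [n nP] : exists n : nat, t%:R / e < n%:R.
  by exists (Num.truncn (t%:R / e)).+1; rewrite truncnS_gt.
have n0 : (0 < n)%N.
  by case: n nP => //; rewrite ltNge divr_ge0 // ltW.
rewrite -lerBlDr; apply: le_trans (infs_le_word_slope n).
apply: lb_le_inf; first by exists (q n), n => /=.
move=> _ [k /= nk <-]; have k0 : (0 < k)%N by apply: leq_trans nk.
apply: le_trans (min_slope_superadditive t0 k0).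
rewrite lerB // ler_pdivrMr ?ltr0n //.
move: nP; rewrite ltr_pdivrMr // => /ltW /le_trans; apply.
by rewrite mulrC ler_wpM2l ?ler_nat // ltW.
Qed.

Lemma word_slope_itv : 0 <= word_slope R w <= 1.
Proof.
apply/andP; split.
  exact: le_trans (min_slope_ge0 1) (min_slope_le_word_slope _).
rewrite /word_slope limn_infE; last exact: bounded_min_slope.
apply: sup_le_ub; first by exists (infs q 0), 0%N.
by move=> _ [n _ <-]; apply: le_trans (infs_min_slope_le (leqnn n)) (min_slope_le1 n).
Qed.

(** The liminf is a limit: every [q k] with [k > 0] lies below it, and the tail infima come
    arbitrarily close to it. *)
Lemma cvg_min_slope : q @ \oo --> word_slope R w.
Proof.
apply/cvgrPdist_le => e e0.
have [_ [n _ <-] hn] : exists2 x, range (infs q) x & word_slope R w - e < x.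
  rewrite /word_slope limn_infE; last exact: bounded_min_slope.
  apply: sup_gt; last by rewrite ltrBlDr ltrDl.
  by exists (infs q 0), 0%N.
near=> k.
have k0 : (0 < k)%N by near: k; exists 1%N.
rewrite ger0_norm ?subr_ge0 ?min_slope_le_word_slope //.
rewrite lerBlDr -lerBlDl; apply: le_trans (ltW hn) _.
by apply: infs_min_slope_le; near: k; exists n.
Unshelve. all: end_near. Qed.

End Slopes.

(** * Binomial coefficients and entropy *)

Section BinomialEntropy.

(** The terms [T j] of the binomial expansion of [((N - k) + k) ^ N] increase up to [j = k] and
    decrease afterwards, so the sum is at most [N.+1] times the term at [k]. *)
Lemma binomial_mode N k : (k <= N)%N ->
  (N ^ N <= N.+1 * ('C(N, k) * (k ^ k * (N - k) ^ (N - k))))%N.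
Proof.
move=> kN; pose T j := ('C(N, j) * ((N - k) ^ (N - j) * k ^ j))%N.
have up j : (j < k)%N -> (T j <= T j.+1)%N.
  move=> jk; rewrite -(leq_pmul2l (ltn0Sn j)) /T.
  rewrite [X in (_ <= X)%N]mulnA mul_bin_left.
  have -> : (N - j = (N - j.+1).+1)%N by lia.
  rewrite !expnS.
  (* The ratio of [T j.+1] to [T j] is [(N - j) * k] over [j.+1 * (N - k)]; only these two products
     need comparing. *)
  have le : (j.+1 * (N - k) <= (N - j.+1).+1 * k)%N.
    have : (j.+1 <= k)%N by [].
    move: (N - k)%N (subnK kN) => t <- jk'.
    have -> : ((t + k - j.+1).+1 = t + (k - j))%N by lia.
    by nia.
  set X := ((N - k) ^ _)%N; set Y := (k ^ j)%N; set C := 'C(N, j).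
  have -> : (j.+1 * (C * ((N - k) * X * Y)) = (j.+1 * (N - k)) * (C * X * Y))%N by ring.
  have -> : ((N - j.+1).+1 * C * (X * (k * Y)) =
             ((N - j.+1).+1 * k) * (C * X * Y))%N by ring.
  by rewrite leq_mul2r le orbT.
have down j : (k <= j)%N -> (j < N)%N -> (T j.+1 <= T j)%N.
  move=> kj jN; rewrite -(leq_pmul2l (ltn0Sn j)) /T.
  rewrite mulnA mul_bin_left.
  have -> : (N - j = (N - j.+1).+1)%N by lia.
  rewrite !expnS.
  have le : ((N - j.+1).+1 * k <= j.+1 * (N - k))%N.
    move: (N - j.+1)%N (subnK jN) => t NE; have -> : (N - k = t.+1 + (j - k))%N by lia.
    by nia.
  set X := ((N - k) ^ _)%N; set Y := (k ^ j)%N; set C := 'C(N, j).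
  have -> : (j.+1 * (C * ((N - k) * X * Y)) = (j.+1 * (N - k)) * (C * X * Y))%N by ring.
  have -> : ((N - j.+1).+1 * C * (X * (k * Y)) =
             ((N - j.+1).+1 * k) * (C * X * Y))%N by ring.
  by rewrite leq_mul2r le orbT.
have upk d : (d <= k)%N -> (T (k - d) <= T k)%N.
  elim: d => [|d IH] dk; first by rewrite subn0.
  apply: leq_trans (IH (ltnW dk)).
  have -> : (k - d = (k - d.+1).+1)%N by lia.
  by apply: up; lia.
have downk d : (k + d <= N)%N -> (T (k + d) <= T k)%N.
  elim: d => [|d IH] dN; first by rewrite addn0.
  rewrite addnS; apply: leq_trans (IH _); last by lia.
  by apply: down; lia.
have Tk j : (j <= N)%N -> (T j <= T k)%N.
  move=> jN; have [jk|kj] := leqP j k.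
    by have := upk (k - j)%N; rewrite subKn //; apply; exact: leq_subr.
  by have := downk (j - k)%N; rewrite subnKC // ?(ltnW kj) //; apply.
have -> : (N ^ N = \sum_(j < N.+1) T j)%N by rewrite -{1}(subnK kN) expnDn.
apply: leq_trans (_ : \sum_(j < N.+1) T k <= _)%N.
  by apply: leq_sum => j _; apply: Tk; rewrite -ltnS.
by rewrite sum_nat_const card_ord leq_mul2l /T (mulnC (k ^ k)%N) leqnn orbT.
Qed.

Context (R : realType).

Definition entropy (y : R) : R := - (y * ln y) - (1 - y) * ln (1 - y).

Lemma entropy_continuous (x : R) : 0 < x < 1 -> {for x, continuous entropy}.
Proof.
move=> /andP[x0 x1].
have c1 : (1 - y : R) @[y --> x] --> 1 - x.
  by apply: cvgB; [exact: cvg_cst | exact: cvg_id].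
apply: cvgB.
  by apply: cvgN; apply: cvgM; [exact: cvg_id | exact: continuous_ln].
apply: cvgM => //; apply: continuous_cvg c1.
by apply: continuous_ln; rewrite subr_gt0.
Qed.

Lemma ln_binomial_ge N k : (0 < k < N)%N ->
  N%:R * entropy (k%:R / N%:R) <= ln (N.+1 * 'C(N, k))%:R :> R.
Proof.
move=> /andP[k0 kN]; have N0 : (0 < N)%N by exact: leq_ltn_trans kN.
have kR : 0 < k%:R :> R by rewrite ltr0n.
have NR : 0 < N%:R :> R by rewrite ltr0n.
have jR : 0 < (N - k)%:R :> R by rewrite ltr0n subn_gt0.
have NkE : 1 - k%:R / N%:R = (N - k)%:R / N%:R :> R.
  by rewrite natrB ?(ltnW kN) // mulrBl divff // gt_eqF.
have C0 : 0 < (N.+1 * 'C(N, k))%:R :> R.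
  by rewrite ltr0n muln_gt0 bin_gt0 (ltnW kN).
have := binomial_mode (ltnW kN); rewrite -(ler_nat R) !(natrM, natrX) mulrA -natrM.
move=> h0; rewrite -ler_ln ?posrE ?exprn_gt0 ?mulr_gt0 ?exprn_gt0 // in h0; move: h0.
rewrite !lnM ?posrE ?mulr_gt0 ?exprn_gt0 // !lnXn //.
rewrite -!(mulr_natr (ln _)) => h.
suff -> : N%:R * entropy (k%:R / N%:R) =
   ln N%:R * N%:R - (ln k%:R * k%:R + ln (N - k)%:R * (N - k)%:R) :> R.
  by rewrite lerBlDr.
rewrite /entropy NkE !ln_div ?posrE //.
have E : (N - k)%:R = N%:R - k%:R :> R by rewrite natrB // ltnW.
by rewrite E; field; rewrite gt_eqF.
Qed.

(** One term of the expansion of [((1 - x) + x) ^+ N = 1] is at most [1]. The bound is affine in [k]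
    for fixed [x], and nondecreasing in [k] when [x <= 1/2], so it treats all [k] up to a given one
    at once. *)
Lemma ln_binomial_le N k (x : R) : (k <= N)%N -> 0 < x < 1 ->
  ln 'C(N, k)%:R <= - (N%:R * ln (1 - x)) + k%:R * (ln (1 - x) - ln x).
Proof.
move=> kN /andP[x0 x1]; have y0 : 0 < 1 - x by rewrite subr_gt0.
have C0 : 0 < 'C(N, k)%:R :> R by rewrite ltr0n bin_gt0.
have : 'C(N, k)%:R * ((1 - x) ^+ (N - k) * x ^+ k) <= 1.
  apply: le_trans (_ : ((1 - x) + x) ^+ N <= _); last by rewrite subrK expr1n.
  rewrite [leRHS]exprDn (bigD1 (inord k)) //= inordK ?ltnS // mulr_natl lerDl.
  by apply: sumr_ge0 => j _; rewrite mulrn_wge0 // mulr_ge0 // exprn_ge0 // ltW.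
move=> h0; rewrite -ler_ln ?posrE ?mulr_gt0 ?exprn_gt0 // in h0; move: h0.
rewrite ln1.
rewrite !lnM ?posrE ?mulr_gt0 ?exprn_gt0 // !lnXn // -!(mulr_natr (ln _)) natrB //.
by lra.
Qed.

Lemma PhiE (x : R) : 0 < x < 1 -> Phi x = expR (entropy x).
Proof.
move=> /andP[x0 x1]; have y0 : 0 < 1 - x by rewrite subr_gt0.
rewrite /Phi /powR !gt_eqF // -expRD div1r -expRN; congr expR.
by rewrite /entropy opprD.
Qed.

Lemma subexponential_ln (f : nat -> nat) : (forall n, 0 < f n)%N ->
  subexponential R f -> ln (f n)%:R / n%:R @[n --> \oo] --> (0 : R).
Proof.
move=> f0 sf; apply/cvgrPdist_le => e e0.
(* Subexponential growth is applied with base [expR e], which gives [f n <= expR e ^+ n] for large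
   [n]. *)
have a1 : 1 < expR e by rewrite expR_gt1.
have /cvgrPdist_le/(_ 1 ltr01) := sf _ a1.
apply: filterS2 (nbhs_infty_gt 0) => n n0.
rewrite !sub0r !normrN.
have fR : 0 < (f n)%:R :> R by rewrite ltr0n.
rewrite ger0_norm ?divr_ge0 ?exprn_ge0 ?expR_ge0 // => h.
rewrite ger0_norm ?divr_ge0 ?ln_ge0 ?ler1n //.
rewrite ler_pdivrMr ?ltr0n //.
move: h; rewrite ler_pdivrMr ?exprn_gt0 ?expR_gt0 // mul1r.
move=> h0; rewrite -ler_ln ?posrE ?exprn_gt0 ?expR_gt0 // in h0; move: h0.
rewrite lnXn ?expR_gt0 // expRK.
by rewrite mulr_natr.
Qed.

Lemma cvg_inv_nat : (n%:R^-1 : R) @[n --> \oo] --> (0 : R).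
Proof. by rewrite -cvg_shiftS; exact: cvg_harmonic. Qed.

(** From [ln y < y] at [y = e / 2 * n], which bounds [ln n] by [e / 2 * n - ln (e / 2)]. *)
Lemma cvg_ln_div : ln n%:R / n%:R @[n --> \oo] --> (0 : R).
Proof.
apply/cvgrPdist_le => e e0.
have e2 : 0 < e / 2 by rewrite divr_gt0.
have h : (- ln (e / 2)) / n%:R @[n --> \oo] --> (0 : R).
  rewrite -[X in _ --> X](mulr0 (- ln (e / 2))).
  apply: cvgM; first exact: cvg_cst.
  exact: cvg_inv_nat.
move/cvgrPdist_le/(_ _ e2): h.
apply: filterS2 (nbhs_infty_gt 0) => n n0.
have nR : 0 < n%:R :> R by rewrite ltr0n.
rewrite !sub0r !normrN => /ler_normlP[_].
rewrite ger0_norm ?divr_ge0 ?ln_ge0 ?ler1n // !ler_pdivrMr // => h.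
have := ln_sublinear (mulr_gt0 e2 nR); rewrite lnM ?posrE //.
by move: h; lra.
Qed.

End BinomialEntropy.

(** * Asymptotics *)

Section Asymptotics.
Context (R : realType) (w : nat -> bool) (m : nat) (hm : (2 <= m)%N).
Local Notation alpha := (word_slope R w).
Local Notation x := ((m%:R + word_slope R w)^-1 : R).

Definition max_bs (N : nat) : nat := \max_(W in validW w hm N) count id W.

Lemma max_bs_attained N : exists2 W : N.-tuple bool, valid w hm W & max_bs N = count id W.
Proof.
have [W [vW _]] : exists W : N.-tuple bool, valid w hm W /\ (0 <= count id W)%N.
  by apply: (@valid_exists _ _ _ _ 0); rewrite muln0.
have [|V] := @eq_bigmax_cond _ (mem (validW w hm N)) (fun W => count id W).
  by apply/card_gt0P; exists W; rewrite finset.inE.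
by rewrite finset.inE => vV E; exists V.
Qed.

Lemma max_bs_ge N (W : N.-tuple bool) : valid w hm W -> (count id W <= max_bs N)%N.
Proof.
by move=> vW; apply: (bigop.bigmax_sup W); rewrite ?finset.inE.
Qed.

Lemma max_bs_leN N : (max_bs N <= N)%N.
Proof.
have [W _ ->] := max_bs_attained N.
by rewrite -[leqRHS](size_tuple W) count_size.
Qed.

Let m2 : 2 <= m%:R :> R. Proof. by rewrite ler_nat. Qed.

Let alpha0 : 0 <= alpha. Proof. by have /andP[] := word_slope_itv R w. Qed.

Let den_gt0 : 0 < m%:R + alpha.
Proof. by rewrite ltr_pwDl // (lt_le_trans _ m2). Qed.

Let x_gt0 : 0 < x. Proof. by rewrite invr_gt0. Qed.

Let x_le : x <= 2^-1.
Proof. by rewrite lef_pV2 ?posrE // (le_trans m2) // lerDl. Qed.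

Let x_itv : 0 < x < 1.
Proof. by rewrite x_gt0 (le_lt_trans x_le) // invf_lt1 // ltr1n. Qed.

(** Take [t] to be the integer part of [N * x] and a factor of length [t] of least slope. That slope
    is at most [alpha], so its blocks fit into length [N]. *)
Lemma max_bs_lower N : N%:R * x - 1 <= (max_bs N)%:R.
Proof.
have Nx0 : 0 <= N%:R * x by rewrite mulr_ge0 // ltW.
have /andP[tN Nt] := truncn_itv Nx0; set t := Num.truncn _ in tN Nt.
have [i qi] := min_slope_attained R w t.
have [|W [vW tW]] := @valid_exists m w hm N i t.
  (* The slope at length [0] is a quotient by zero, so [t = 0] is treated apart. *)
  rewrite -(ler_nat R) natrD natrM; case: (posnP t) tN => [->|t0] tN.
    by rewrite mulr0 add0r ler_nat.
  have -> : (count id (factor w i t))%:R = min_slope R w t * t%:R :> R.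
    by rewrite qi divfK // pnatr_eq0 -lt0n.
  rewrite -mulrDl; apply: le_trans (_ : (m%:R + alpha) * t%:R <= _).
    by rewrite ler_wpM2r // lerD2l min_slope_le_word_slope.
  by rewrite mulrC -ler_pdivlMr.
rewrite lerBlDr (le_trans (ltW Nt)) // -natr1 lerD2r ler_nat.
exact: leq_trans tW (max_bs_ge vW).
Qed.

Lemma max_bs_upper N :
  (max_bs N)%:R * (m%:R + min_slope R w (max_bs N)) <= N%:R + m%:R.
Proof.
have [W vW ->] := max_bs_attained N; have [i] := valid_count vW.
rewrite -(ler_nat R) !natrD natrM => h; apply: le_trans h.
by rewrite mulrDr mulrC lerD2l mulrC ones_ge.
Qed.

Lemma cvg_max_bs_infty : max_bs N @[N --> \oo] --> \oo.
Proof.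
apply/cvgnyPge => M; near=> N.
rewrite -(ler_nat R); apply: le_trans (max_bs_lower N).
rewrite lerBrDr -ler_pdivrMr //.
near: N; exact: nbhs_infty_ger.
Unshelve. all: end_near. Qed.

(** The upper bound involves the least slope at length [max_bs N], which tends to [alpha] because
    [max_bs N] tends to infinity. *)
Lemma cvg_max_bs : (max_bs N)%:R / N%:R @[N --> \oo] --> x.
Proof.
have qk : min_slope R w (max_bs N) @[N --> \oo] --> alpha.
  exact: cvg_comp cvg_max_bs_infty (@cvg_min_slope R w).
apply: (@squeeze_cvgr _ _ _ _ (fun N => x - N%:R^-1)
  (fun N => (1 + m%:R * N%:R^-1) / (m%:R + min_slope R w (max_bs N)))).
- near=> N; have N0 : (0 < N)%N by near: N; exists 1%N.
  have NR : 0 < N%:R :> R by rewrite ltr0n.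
  apply/andP; split.
    rewrite ler_pdivlMr // mulrBl mulVf ?gt_eqF // mulrC.
    exact: max_bs_lower.
  have d0 : 0 < m%:R + min_slope R w (max_bs N).
    by rewrite ltr_pwDl ?min_slope_ge0 // (lt_le_trans _ m2).
  rewrite ler_pdivrMr // mulrAC ler_pdivlMr // mulrDl mul1r mulfVK ?gt_eqF //.
  exact: max_bs_upper.
- rewrite -[X in _ --> X]subr0; apply: cvgB; first exact: cvg_cst.
  exact: cvg_inv_nat.
rewrite -[X in _ --> X]mul1r; apply: cvgM.
  rewrite -[X in _ --> X]addr0 -(mulr0 m%:R).
  apply: cvgD; first exact: cvg_cst.
  by apply: cvgM; [exact: cvg_cst | exact: cvg_inv_nat].
apply: cvgV; first by rewrite gt_eqF.
by apply: cvgD => //; exact: cvg_cst.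
Unshelve. all: end_near. Qed.

Lemma Comp_gt0 n : (0 < Comp w n)%N.
Proof. by apply/card_gt0P; exists (subword w 0 n); exact: is_subwordT. Qed.

Hypothesis hcomp : subexponential R (Comp w).
Context (F : fieldType).
Local Notation c := (codim (wordAlg w hm F)).

Lemma ln_codim_ge N : (0 < max_bs N < N)%N ->
  N%:R * entropy ((max_bs N)%:R / N%:R) <= ln (c N.+1)%:R :> R.
Proof.
move=> kN; apply: le_trans (ln_binomial_ge R kN) _.
case/andP: kN => k0 kN; have N0 : (0 < N)%N by exact: leq_ltn_trans kN.
have [W vW E] := max_bs_attained N.
have := codim_ge F N0 vW; rewrite -E => h.
have C0 : (0 < N.+1 * 'C(N, max_bs N))%N by rewrite muln_gt0 bin_gt0 (ltnW kN).
by rewrite ler_ln ?posrE ?ltr0n ?ler_nat // (leq_trans C0).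
Qed.

(** The word [V] with the largest binomial coefficient need not have the most letters [b]. The
    affine bound at [x] does grow with the number of [b], which allows [max_bs N] in its place. *)
Lemma ln_codim_le N : (0 < max_bs N < N)%N ->
  ln (c N.+1)%:R <= ln N.+1%:R + (ln m.+1%:R + ln (Comp w N.+1)%:R +
    (N%:R * - ln (1 - x) + (max_bs N)%:R * (ln (1 - x) - ln x))) :> R.
Proof.
case/andP=> k0 kN; have N0 : (0 < N)%N by exact: leq_ltn_trans kN.
have [W0 vW0 _] := max_bs_attained N.
have [|V + CV] := @eq_bigmax_cond _ (mem (validW w hm N)) (fun W => 'C(N, count id W)).
  by apply/card_gt0P; exists W0; rewrite finset.inE.
rewrite finset.inE => vV.
have h := @codim_le F m w hm N N0 'C(N, count id V) _.
have {}h : (c N.+1 <= N.+1 * (m.+1 * Comp w N.+1 * 'C(N, count id V)))%N.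
  apply: h => W vW; rewrite -CV.
  by apply: (bigop.bigmax_sup W); rewrite ?finset.inE.
have cN : (count id V <= N)%N by rewrite -[leqRHS](size_tuple V) count_size.
have Cp := Comp_gt0 N.+1.
have c0 : (0 < c N.+1)%N.
  apply: leq_trans (codim_ge F N0 vV); rewrite muln_gt0 bin_gt0 //.
apply: (@le_trans _ _ (ln (N.+1 * (m.+1 * Comp w N.+1 * 'C(N, count id V)))%:R)).
  rewrite ler_ln ?posrE ?ltr0n ?ler_nat //.
  by rewrite !muln_gt0 Cp bin_gt0.
rewrite !natrM !lnM ?posrE ?mulr_gt0 ?ltr0n ?bin_gt0 //.
rewrite !lerD2l; apply: le_trans (ln_binomial_le cN x_itv) _.
rewrite mulrN lerD2l ler_wpM2r ?ler_nat ?max_bs_ge //.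
(* The slope [ln (1 - x) - ln x] of the affine bound is nonnegative since [x <= 1/2], a consequence
   of [m >= 2]. *)
rewrite subr_ge0 ler_ln ?posrE ?subr_gt0 //; first by have := x_le; lra.
by case/andP: x_itv.
Qed.

Lemma near_max_bs : \forall N \near \oo, (0 < max_bs N < N)%N.
Proof.
have /andP[x0 x1] := x_itv.
near=> N; have N0 : (0 < N)%N by near: N; exists 1%N.
apply/andP; split; first by near: N; have /cvgnyPgt := cvg_max_bs_infty; apply.
rewrite -(ltr_nat R) -[ltRHS]mul1r -ltr_pdivrMr ?ltr0n //.
by near: N; exact: (cvgr_lt _ cvg_max_bs).
Unshelve. all: end_near. Qed.

Lemma cvg_ln_codim : ln (c N.+1)%:R / N.+1%:R @[N --> \oo] --> entropy x.
Proof.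
have [x0 x1] := andP x_itv.
have r1 : N%:R / N.+1%:R @[N --> \oo] --> (1 : R).
  have h : (1 - N.+1%:R^-1 : R) @[N --> \oo] --> (1 : R).
    rewrite -[X in _ --> X]subr0; apply: cvgB; first exact: cvg_cst.
    exact: cvg_harmonic.
  apply: cvg_trans h; apply: near_eq_cvg; near=> N.
  by rewrite -[in RHS]natr1; field; rewrite natr1 pnatr_eq0.
have ck := cvg_max_bs.
apply: (@squeeze_cvgr _ _ _ _
  (fun N => N%:R / N.+1%:R * entropy ((max_bs N)%:R / N%:R))
  (fun N => ln N.+1%:R / N.+1%:R + (ln m.+1%:R / N.+1%:R +
     ln (Comp w N.+1)%:R / N.+1%:R +
     N%:R / N.+1%:R * (- ln (1 - x) + (max_bs N)%:R / N%:R * (ln (1 - x) - ln x))))).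
- near=> N.
  have kN : (0 < max_bs N < N)%N by near: N; exact: near_max_bs.
  have N0 : 0 < N%:R :> R by rewrite ltr0n; case/andP: kN => _; exact: leq_ltn_trans.
  apply/andP; split.
    by rewrite mulrAC ler_pM2r ?invr_gt0 // ln_codim_ge.
  rewrite ler_pdivrMr //; apply: le_trans (ln_codim_le kN) _.
  rewrite le_eqVlt; apply/orP; left; apply/eqP.
  by field; rewrite gt_eqF //= gt_eqF // ltr_wpDr // ltW.
- rewrite -[X in _ --> X]mul1r; apply: cvgM => //.
  by apply: continuous_cvg ck; exact: entropy_continuous.
(* The affine bound is the tangent to the entropy at [x], so both bounds have the same limit
   there. *)
have -> : entropy x = 0 + (0 + 0 + 1 * (- ln (1 - x) + x * (ln (1 - x) - ln x))).
  by rewrite /entropy; ring.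
apply: cvgD; first by have := @cvg_ln_div R; rewrite -cvg_shiftS.
apply: cvgD; first apply: cvgD.
- rewrite -[X in _ --> X](mulr0 (ln m.+1%:R)).
  by apply: cvgM; [exact: cvg_cst | exact: cvg_harmonic].
- by have := subexponential_ln Comp_gt0 hcomp; rewrite -cvg_shiftS.
apply: cvgM => //; apply: cvgD; first exact: cvg_cst.
by apply: cvgM => //; exact: cvg_cst.
Unshelve. all: end_near. Qed.

Lemma cvg_codim_root : codim_root R (wordAlg w hm F) @ \oo --> Phi x.
Proof.
rewrite (PhiE x_itv) -cvg_shiftS.
have h : expR (ln (c N.+1)%:R / N.+1%:R) @[N --> \oo] --> expR (entropy x).
  by apply: continuous_cvg cvg_ln_codim; exact: continuous_expR.
apply: cvg_trans h; apply: near_eq_cvg; near=> N.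
have kN : (0 < max_bs N < N)%N by near: N; exact: near_max_bs.
have N0 : (0 < N)%N by case/andP: kN => _; exact: leq_ltn_trans.
have [W vW E] := max_bs_attained N.
(* [powR] is the exponential of a multiple of the logarithm only at a nonzero base. *)
have c0 : (0 < c N.+1)%N.
  apply: leq_trans (codim_ge F N0 vW); rewrite muln_gt0 bin_gt0 /= -E.
  exact: max_bs_leN.
by rewrite /= /codim_root /powR pnatr_eq0 gtn_eqF // mulrC.
Unshelve. all: end_near. Qed.

End Asymptotics.

Theorem mainTheorem1 (R : realType) (F : fieldType) (hF : [pchar F] =i pred0)
    (w : nat -> bool) (alpha : R) (hw : word_slope R w = alpha)
    (hcomp : subexponential R (Comp w)) (m : nat) (hm : (2 <= m)%N) :
  cvgn (codim_root R (wordAlg w hm F)) /\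
  PIexp R (wordAlg w hm F) = Phi (1 / (m%:R + alpha)).
Proof.
have h := cvg_codim_root hm hcomp F.
split; first exact: cvgP h.
by rewrite /PIexp (cvg_lim _ h) // div1r hw.
Qed.
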